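(* If $s=-n\in\mathbb Z_-$, the derivative of order $s$ of $ax^\alpha$ (in the sense of the second definition) is the indefinite integral of order $n$ of $ax^\alpha$.
   Context: Second definition. For any $(s,\alpha)\in\mathbb Q\times\mathbb R\setminus\{(-1,-1)\}$ and $x\in\mathbb R^+$, a derivative of order $s$ of the function $f(x)=ax^\alpha$ (equal to $ae^{\alpha\ln x}$ for $x>0$, and at $x=0$ equal to $a$ if $\alpha=0$ and to $0$ if $\alpha\neq0$) is defined by $$\frac{d^s(ax^\alpha)}{dx^s}=a\frac{d^sx^\alpha}{dx^s}=a\frac{\Gamma(\alpha+1)}{\Gamma(\alpha-s+1)}x^{\alpha-s}+\sum_{k=-|[s]|}^{-1}c_k\frac{x^{k-s}}{\Gamma(k-[s]+1)},$$ where the $c_k$ are arbitrary constants and $[s]$ is the entire part of $s$ (truncation toward zero, so $[-n]=-n$). Here $\Gamma$ is the gamma function, and $1/\Gamma$ is taken to be $0$ at the poles of $\Gamma$. The indefinite integral of order $n$ is the result of integrating $n$ times, with arbitrary integration constants.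
   Formalization: For s=-n, α in {-n,…,-1} is excluded (Γ(α+1) is infinite over a finite denominator, e.g. s=-2, α=-1); when both Gammas are at poles the quotient is its limit in α; x=0 is included only for α>-1, as ax^α has no antiderivative up to 0 otherwise. *)

(* Defs.v *)
From HB Require Import structures.
From mathcomp Require Import all_boot all_order all_algebra.
From mathcomp Require Import all_classical all_reals all_analysis.
Set Implicit Arguments.
Unset Strict Implicit.
Unset Printing Implicit Defensive.
Import Order.TTheory GRing.Theory Num.Theory.
Import numFieldNormedType.Exports.
Local Open Scope classical_set_scope.
Local Open Scope ring_scope.

Definition euler_Gamma {R : realType} (x : R) : R :=
  \int[lebesgue_measure]_(t in `]0, +oo[) (t `^ (x - 1) * expR (- t)).

(* For x <= 0, the Euler integral is continued by Gamma(x+1) = x * Gamma(x),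
   shifting x by the least m such that x + m > 0. At the poles
   0, -1, -2, ... one factor x + i vanishes, so Gamma x = 0 there and, as
   0^-1 = 0, also (Gamma x)^-1 = 0, which is the convention for 1/Gamma. *)
Definition Gamma {R : realType} (x : R) : R :=
  if 0 < x then euler_Gamma x
  else let m := (Num.truncn (- x)).+1 in
       euler_Gamma (x + m%:R) / \prod_(i < m) (x + i%:R).

Definition Gamma_pole {R : realType} (x : R) : bool :=
  (x <= 0) && (x \is a Num.int).

(* The quotient Gamma(p) / Gamma(q). If p and q are both poles it is given its
   finite limiting value along (p + e, q + e): for p = alpha + 1 and
   q = alpha - s + 1 this extends the quotient by continuity in alpha.
   If p is a pole and q is not, the quotient is infinite and the value of this
   function is meaningless. *)
Definition Gamma_quot {R : realType} (p q : R) : R :=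
  if Gamma_pole p then lim (Gamma (p + e) / Gamma (q + e) @[e --> 0^'])
  else Gamma p / Gamma q.

(* truncation toward zero *)
Definition entire_part (s : rat) : int :=
  if 0 <= s then Num.floor s else Num.ceil s.

(* The second condition says that the quotient of Gammas is finite. For s = -n
   it excludes alpha = -1, ..., -n, where integrating n times gives a
   logarithm. *)
Definition deriv_defined {R : realType} (s : rat) (alpha : R) : Prop :=
  (s, alpha) <> (- 1, - 1) /\
  (Gamma_pole (alpha + 1) -> Gamma_pole (alpha - ratr s + 1)).

(* The index k = -|[s]|, ..., -1 is written k = -(j+1) with j < |[s]|.
   The convention for x^beta at x = 0 (1 if beta = 0, and 0 otherwise) is that
   of the library function powR. *)
Definition monomial_deriv {R : realType} (s : rat) (a alpha : R)
    (c : int -> R) (x : R) : R :=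
  a * Gamma_quot (alpha + 1) (alpha - ratr s + 1) * x `^ (alpha - ratr s)
  + \sum_(j < `|entire_part s|%N)
      let k : int := - (j.+1)%:Z in
      c k * (x `^ (k%:~R - ratr s) / Gamma ((k - entire_part s)%:~R + 1)).

(* All derivatives of order s of a x^alpha on I, one for each choice of the
   constants c_k; functions matter only through their values on I. *)
Definition derivatives {R : realType} (I : set R) (s : rat) (a alpha : R) :
    set (R -> R) :=
  [set F : R -> R | exists c : int -> R,
    forall x, I x -> F x = monomial_deriv s a alpha c x].

(* F' = f in the interior of I; at an endpoint belonging to I, F is only
   required to be continuous, as for the antiderivative 2 sqrt x of
   1 / sqrt x on [0, +oo[. *)
Definition antiderivative {R : realType} (I : set R) (f F : R -> R) : Prop :=
  {within I, continuous F} /\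
  forall x : R, I° x -> is_derive x 1 F (f x).

Fixpoint indefinite_integrals {R : realType} (I : set R) (n : nat)
    (f : R -> R) : set (R -> R) :=
  if n is m.+1 then
    [set F : R -> R |
      exists2 G, indefinite_integrals I m f G & antiderivative I G F]
  else [set F : R -> R | forall x, I x -> F x = f x].

(* Main.v *)
Require Import Defs.
From HB Require Import structures.
From mathcomp Require Import all_boot all_order all_algebra.
From mathcomp Require Import all_classical all_reals all_analysis.
From mathcomp Require Import measurable_realfun ring lra zify.
Import Order.TTheory GRing.Theory Num.Theory.
Import numFieldNormedType.Exports.
Local Open Scope classical_set_scope.
Local Open Scope ring_scope.

(** Both sets consist of the functions which on the half-line have the form
    a x^(alpha+n) / ((alpha+1) (alpha+2) ... (alpha+n)) + p(x), with p an
    arbitrary polynomial of degree less than n.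

    For the indefinite integrals this is an induction on n
    ([indefinite_integralsE]).  The displayed function with n+1 in place of n
    is an antiderivative of the one with n: one more factor alpha+n+1 in the
    denominator compensates the exponent that differentiation brings down, and
    writing p in the basis x^j / j! makes differentiation a shift of its
    coefficients ([is_derive_power_primitive]).  All other antiderivatives
    differ from it by a constant, by the mean value theorem
    ([antiderivative_unique]), and this constant is the new coefficient of p.
    On the closed half-line alpha > -1 keeps the exponent alpha+n+1 positive,
    so that the power extends continuously by 0 at the origin.

    For the fractional derivatives, s = -n turns x^(k-s) / Gamma(k-[s]+1) into
    x^j / j! with j = k+n running over 0, ..., n-1, so the sum over k is p,
    and it remains to see that
    Gamma(alpha+1) / Gamma(alpha+n+1) = 1 / ((alpha+1) ... (alpha+n))
    ([Gamma_quotE]).  Off the poles this is the functional equation of Gamma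
    together with the fact that Gamma does not vanish.  If alpha+1 is a pole,
    the identity holds at all nearby points, and the right-hand side is
    continuous at alpha+1 because the definedness hypothesis keeps 0 out of
    the factors alpha+1, ..., alpha+n.

    The functional equation for positive arguments is integration by parts in
    the Euler integral.  It is carried out with values in the extended reals
    ([euler_integralD1]), where it needs no convergence; finiteness of the
    integral is then deduced from it. *)

(** * The Euler integral *)

(** The term of order m+1 in the exponential series already beats b^x once
    m >= x. *)
Lemma powR_expRN_le {R : realType} {x b : R} {m : nat} :
  x <= m%:R -> 1 <= b -> b `^ x * expR (- b) <= (m.+1)`!%:R / b.
Proof.
move=> xm b1; have b0 : 0 < b by exact: lt_le_trans b1.
rewrite expRN ler_pdivrMr ?expR_gt0//.
have h1 : b `^ x <= b ^+ m.
  by rewrite -powR_mulrn ?(ltW b0)//; exact: ler_powR.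
have h2 : b ^+ m.+1 / (m.+1)`!%:R <= expR b.
  by have := expR_ge1Dxn m (ltW b0); lra.
rewrite (le_trans h1)//.
have f0 : 0 < (m.+1)`!%:R :> R by rewrite ltr0n fact_gt0.
rewrite -ler_pdivrMl ?divr_gt0// invf_div (le_trans _ h2)//.
by rewrite exprS mulrAC.
Qed.

Lemma cvg_powR_expRN {R : realType} (x : R) :
  (k.+2%:R : R) `^ x * expR (- k.+2%:R) @[k --> \oo] --> (0 : R).
Proof.
have [m xm] : exists m : nat, x <= m%:R.
  by exists (Num.truncn x).+1; rewrite ltW// truncnS_gt.
apply: (@squeeze_cvgr _ _ _ _ (fun=> 0) (fun k => (m.+1)`!%:R * harmonic k)).
- near=> k; rewrite mulr_ge0 ?powR_ge0 ?expR_ge0//=.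
  rewrite (le_trans (powR_expRN_le xm _))// ?ler1n//.
  by rewrite ler_wpM2l// lef_pV2 ?posrE// ler_nat.
- exact: cvg_cst.
- rewrite -[X in _ --> X](mulr0 ((m.+1)`!%:R : R)).
  by apply: cvgM; [exact: cvg_cst|exact: cvg_harmonic].
Unshelve. all: by end_near. Qed.

(** Extended-real valued, so that limits and the functional equation make sense
    before the integral is known to be finite. *)
Definition euler_integral {R : realType} (x : R) : \bar R :=
  (\int[lebesgue_measure]_(t in `]0%R, +oo[) (t `^ (x - 1) * expR (- t))%:E)%E.

Lemma euler_integral_ge0 {R : realType} (x : R) : (0 <= euler_integral x)%E.
Proof.
by apply: integral_ge0 => t _; rewrite lee_fin mulr_ge0 ?powR_ge0 ?expR_ge0.
Qed.

Lemma is_derive_expRN {R : realType} (t : R) :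
  is_derive t 1 (fun t => - expR (- t)) (expR (- t)).
Proof.
apply: is_derive_eq.
by rewrite /GRing.scale/= !mulrN1 opprK.
Qed.

Lemma measurable_euler_integrand {R : realType} (x : R) (D : set R) :
  measurable_fun D (fun t : R => t `^ (x - 1) * expR (- t)).
Proof.
apply: measurable_funTS; apply: measurable_funM.
  exact: measurable_powR.
by apply: measurableT_comp => //; exact: measurable_funN.
Qed.

Lemma derivable_LRcontinuous {R : realType} {f df : R -> R} {a b : R} :
  (forall t, t \in `[a, b] -> is_derive t 1 f (df t)) -> a < b ->
  derivable_oo_LRcontinuous f a b.
Proof.
move=> fdf ab.
have cf t : t \in `[a, b] -> {for t, continuous f}.
  move=> /fdf tf; apply: differentiable_continuous.
  by apply/derivable1_diffP; exact: ex_derive.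
split.
- by move=> t /subset_itv_oo_cc/fdf[].
- by apply: cvg_at_right_filter; apply: cf; rewrite in_itv/= lexx ltW.
- by apply: cvg_at_left_filter; apply: cf; rewrite in_itv/= lexx ltW.
Qed.

Lemma within_continuousM {R : realType} (A : set R) (f g : R -> R) :
  {within A, continuous f} -> {within A, continuous g} ->
  {within A, continuous (fun t => f t * g t)}.
Proof. by move=> cf cg t; apply: continuousM; [exact: cf|exact: cg]. Qed.

(** Only on compact subintervals of the positive half-line: for 0 < x < 1 the
    integrand on the right is unbounded at 0. *)
Lemma euler_integral_parts {R : realType} (x a b : R) : 0 < a -> a < b ->
  (\int[lebesgue_measure]_(t in `[a, b]) (t `^ (x + 1 - 1) * expR (- t))%:E =
   (a `^ x * expR (- a) - b `^ x * expR (- b))%:E +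
   x%:E * \int[lebesgue_measure]_(t in `[a, b])
            (t `^ (x - 1) * expR (- t))%:E)%E.
Proof.
move=> a0 ab.
have pos t : t \in `[a, b] -> 0 < t.
  by rewrite in_itv/= => /andP[+ _]; exact: lt_le_trans.
have powD (y t : R) : t \in `[a, b] ->
    is_derive t 1 (@powR R ^~ y) (y * t `^ (y - 1)).
  by move=> /pos ?; exact: is_derive1_powR.
have cpow y : {within `[a, b], continuous (@powR R ^~ y)}.
  apply: derivable_within_continuous => t tab.
  by case: (powD y t tab).
have ce : {within `[a, b], continuous (fun t : R => expR (- t))}.
  apply: continuous_subspaceT => t.
  by apply: continuous_comp; [exact: opp_continuous|exact: continuous_expR].
rewrite addrK (@integration_by_parts R (@powR R ^~ x) (fun t => - expR (- t))
  (fun t => x * t `^ (x - 1)) (fun t => expR (- t)))//.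
- under eq_integral => t _ do rewrite mulrN -mulrA -mulNr EFinM.
  rewrite integralZl//=; last first.
    apply: continuous_compact_integrable; first exact: segment_compact.
    exact: within_continuousM (cpow (x - 1)) ce.
  by rewrite !mulrN opprK [(- _ + _)%R]addrC EFinN mulNe oppeK.
- by apply: within_continuousM => // t; exact: cst_continuous.
- exact: derivable_LRcontinuous (powD x) ab.
- by move=> t /subset_itv_oo_cc /(powD x)[_ dt]; rewrite derive1E.
- exact: (@derivable_LRcontinuous R (fun t => - expR (- t))
    (fun t => expR (- t)) a b (fun t _ => is_derive_expRN t) ab).
- by move=> t _; have [_ dt] := is_derive_expRN t; rewrite derive1E.
Qed.

Lemma bigcup_itv_pos {R : realType} :
  \bigcup_k `[k.+1%:R^-1 : R, k.+2%:R]%classic = `]0, +oo[%classic.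
Proof.
apply/seteqP; split=> t /=.
  case=> k _ /=; rewrite !in_itv/= andbT => /andP[+ _].
  by apply: lt_le_trans; rewrite invr_gt0.
rewrite in_itv/= andbT => t0.
exists (maxn (Num.truncn t) (Num.truncn t^-1)) => //=.
rewrite in_itv/=; apply/andP; split.
  rewrite -[t in leRHS]invrK lef_pV2 ?posrE ?invr_gt0//.
  by rewrite ltW// (lt_le_trans (truncnS_gt _))// ler_nat ltnS leq_maxr.
rewrite ltW// (lt_le_trans (truncnS_gt _))// ler_nat ltnS.
by rewrite leqW ?leq_maxl.
Qed.

Lemma cvg_euler_integral {R : realType} (x : R) :
  (\int[lebesgue_measure]_(t in `[k.+1%:R^-1%R, k.+2%:R])
      (t `^ (x - 1) * expR (- t))%:E)%E @[k --> \oo] --> euler_integral x.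
Proof.
rewrite /euler_integral -bigcup_itv_pos.
apply: ge0_nondecreasing_set_cvg_integral.
- apply/nondecreasing_seqP => k; rewrite subsetEset => t /=.
  rewrite !in_itv/= => /andP[h1 h2]; apply/andP; split.
    by rewrite (le_trans _ h1)// lef_pV2 ?posrE// ler_nat.
  by rewrite (le_trans h2)// ler_nat.
- by move=> k; exact: measurable_itv.
- by move=> k; apply/measurable_EFinP; exact: measurable_euler_integrand.
- by move=> k t _; rewrite lee_fin mulr_ge0 ?powR_ge0 ?expR_ge0.
Qed.

(** The boundary terms of the integration by parts on [1/(k+1), k+2] tend to 0,
    and the integrals increase to the Euler integrals, possibly infinite. *)
Lemma euler_integralD1 {R : realType} (x : R) : 0 < x ->
  (euler_integral (x + 1) = x%:E * euler_integral x)%E.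
Proof.
move=> x0.
have bnd : ((k.+1%:R^-1 : R) `^ x * expR (- k.+1%:R^-1) -
            k.+2%:R `^ x * expR (- k.+2%:R)) @[k --> \oo] --> (0 : R).
  rewrite -[X in _ --> X](subr0 (0 : R)).
  apply: cvgB; last exact: cvg_powR_expRN.
  rewrite -[X in _ --> X](mul0r (expR (- 0) : R)); apply: cvgM.
    apply: ((cvg_at_rightP _ _ _).1 (powR_cvg0 x0)); split=> [k|].
      by rewrite invr_gt0.
    exact: cvg_harmonic.
  apply: continuous_cvg; first exact: continuous_expR.
  by apply: cvgN; exact: cvg_harmonic.
have ab k : (k.+1%:R^-1 : R) < k.+2%:R.
  by rewrite (@le_lt_trans _ _ 1)// ?ltr1n// invf_le1 ?ler1n.
have parts : (\int[lebesgue_measure]_(t in `[k.+1%:R^-1%R, k.+2%:R])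
      (t `^ (x + 1 - 1) * expR (- t))%:E)%E @[k --> \oo] -->
    (0 + x%:E * euler_integral x)%E.
  under eq_cvg => k do
    rewrite (euler_integral_parts x _ _ _ (ab k)) ?invr_gt0//.
  apply: cvgeD.
  - by rewrite fin_num_adde_defr.
  - by apply: cvg_EFin; [exact: nearW|exact: bnd].
  - by apply: cvgeZl => //; exact: cvg_euler_integral.
rewrite -[RHS]add0e.
exact: (cvg_unique (@ereal_hausdorff R) (cvg_euler_integral (x + 1)) parts).
Qed.

Lemma euler_integral1 {R : realType} : euler_integral (1 : R) = 1%E.
Proof.
rewrite /euler_integral subrr.
under eq_integral do rewrite powRr0 mul1r.
rewrite integral_itv_obnd_cbnd; last first.
  by apply/measurable_EFinP; apply: measurable_funTS;
    apply: measurableT_comp => //; exact: measurable_funN.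
have ce : continuous (fun t : R => expR (- t)).
  move=> t; apply: continuous_comp; first exact: opp_continuous.
  exact: continuous_expR.
rewrite (@ge0_continuous_FTC2y R _ (fun t => - expR (- t)) 0 0)//.
- by rewrite oppr0 expR0 -EFinB sub0r opprK.
- exact: continuous_subspaceT.
- by rewrite -[X in _ --> X]oppr0; apply: cvgN; exact: cvgr_expR.
- by apply: cvg_at_right_filter; apply: cvgN; exact: ce.
- by move=> t _; have [_ dt] := is_derive_expRN t; rewrite derive1E.
Qed.

Lemma euler_integral_nat {R : realType} (m : nat) :
  (euler_integral (m.+1%:R : R) < +oo)%E.
Proof.
elim: m => [|m IH]; first by rewrite euler_integral1 ltry.
rewrite -natr1 euler_integralD1//.
by rewrite lte_mul_pinfty ?lee_fin ?ler0n.
Qed.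

(** The functional equation carries finiteness from x+1 down to x, so that
    x >= 1 may be assumed; then t^(x-1) <= 1 + t^m for m >= x-1, and the
    integral is bounded by the sum of its values at 1 and at m+1. *)
Lemma euler_integral_lty {R : realType} (x : R) : 0 < x ->
  (euler_integral x < +oo)%E.
Proof.
move=> x0.
suff h (y : R) : 1 <= y -> (euler_integral y < +oo)%E.
  have := h (x + 1) _; rewrite lerDr => /(_ (ltW x0)).
  rewrite euler_integralD1// => xlty.
  rewrite -(@lte_pmul2l _ x%:E)// ?lte_fin//.
  by rewrite gt0_muley ?lte_fin.
move=> y1; have [m ym] : exists m : nat, y - 1 <= m%:R.
  by exists (Num.truncn (y - 1)).+1; rewrite ltW// truncnS_gt.
apply: (@le_lt_trans _ _ (euler_integral 1 + euler_integral (m.+1%:R))%E);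
  last first.
  by rewrite euler_integral1 lte_add_pinfty ?ltry ?euler_integral_nat.
have mF (z : R) : measurable_fun (`]0, +oo[%classic : set R)
    (fun t : R => (t `^ (z - 1) * expR (- t))%:E).
  by apply/measurable_EFinP; exact: measurable_euler_integrand.
have F0 (z t : R) : (0 <= (t `^ (z - 1) * expR (- t))%:E)%E.
  by rewrite lee_fin mulr_ge0 ?powR_ge0 ?expR_ge0.
rewrite /euler_integral -ge0_integralD//=; [|exact: mF|exact: mF].
apply: ge0_le_integral => //=; [exact: mF| |].
  by apply: emeasurable_funD; exact: mF.
move=> t; rewrite in_itv/= andbT => t0.
rewrite lee_fin -mulrDl ler_wpM2r ?expR_ge0// subrr powRr0.
have -> : m.+1%:R - 1 = m%:R :> R by rewrite -natr1 addrK.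
have [t1|/ltW t1] := leP t 1.
- rewrite (@le_trans _ _ 1)// ?lerDl ?powR_ge0//.
  rewrite -[leRHS](powRr0 t); apply: ger_powR; first by rewrite t0.
  by rewrite subr_ge0.
- by rewrite (@le_trans _ _ (t `^ m%:R))// ?lerDr//; exact: ler_powR.
Qed.

(** After the same reduction to x >= 1, the integrand is at least e^-2 on
    [1, 2]. *)
Lemma euler_integral_gt0 {R : realType} (x : R) : 0 < x ->
  (0 < euler_integral x)%E.
Proof.
move=> x0.
suff h (y : R) : 1 <= y -> (0 < euler_integral y)%E.
  have := h (x + 1) _; rewrite lerDr => /(_ (ltW x0)).
  rewrite euler_integralD1//.
  by rewrite -[X in (X < _ -> _)%E](mule0 x%:E) lte_pmul2l// lte_fin.
move=> y1.
apply: (@lt_le_trans _ _ (\int[lebesgue_measure]_(t in `[1%R, 2%R])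
    (cst (expR (- 2))%:E t))%E).
  rewrite integral_cst//= lebesgue_measure_itv/= lte_fin ltr1n.
  by rewrite -EFinB -EFinM lte_fin mulr_gt0 ?expR_gt0//; lra.
apply: (@le_trans _ _ (\int[lebesgue_measure]_(t in `[1%R, 2%R])
    (t `^ (y - 1) * expR (- t))%:E)%E).
  apply: ge0_le_integral => //=.
  - by apply/measurable_EFinP; exact: measurable_euler_integrand.
  - move=> t; rewrite in_itv/= => /andP[t1 t2].
    rewrite lee_fin -[leLHS]mul1r ler_pM ?expR_ge0//; last first.
      by rewrite ler_expR lerN2.
    by rewrite -[leLHS](powRr0 t); apply: ler_powR => //; rewrite subr_ge0.
apply: ge0_subset_integral => //=.
- by apply/measurable_EFinP; exact: measurable_euler_integrand.
- by move=> t _; rewrite lee_fin mulr_ge0 ?powR_ge0 ?expR_ge0.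
- move=> t /=; rewrite !in_itv/= andbT => /andP[t1 _]; exact: lt_le_trans t1.
Qed.

Lemma euler_GammaD1 {R : realType} (x : R) : 0 < x ->
  euler_Gamma (x + 1) = x * euler_Gamma x.
Proof.
move=> x0; rewrite /euler_Gamma /Rintegral -!/(euler_integral _).
rewrite euler_integralD1// fineM// ge0_fin_numE ?euler_integral_lty//.
exact: euler_integral_ge0.
Qed.

Lemma euler_Gamma_gt0 {R : realType} (x : R) : 0 < x -> 0 < euler_Gamma x.
Proof.
move=> x0; rewrite /euler_Gamma /Rintegral -/(euler_integral _).
by rewrite fine_gt0// euler_integral_gt0// euler_integral_lty.
Qed.

Lemma euler_Gamma1 {R : realType} : euler_Gamma (1 : R) = 1.
Proof.
by rewrite /euler_Gamma /Rintegral -/(euler_integral _) euler_integral1.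
Qed.

(** * The gamma function and rising factorials *)

Definition rising_factorial {R : pzSemiRingType} (x : R) (n : nat) : R :=
  \prod_(i < n) (x + i%:R).

Lemma rising_factorialS {R : pzSemiRingType} (x : R) (n : nat) :
  rising_factorial x n.+1 = rising_factorial x n * (x + n%:R).
Proof. exact: big_ord_recr. Qed.

Lemma rising_factorialD {R : pzSemiRingType} (x : R) (m n : nat) :
  rising_factorial x (m + n) =
  rising_factorial x m * rising_factorial (x + m%:R) n.
Proof.
elim: n => [|n IH].
  by rewrite addn0 [in RHS]/rising_factorial big_ord0 mulr1.
by rewrite addnS !rising_factorialS IH natrD addrA mulrA.
Qed.

Lemma rising_factorial_neq0 {R : idomainType} (x : R) (n : nat) :
  (forall i, (i < n)%N -> x + i%:R != 0) -> rising_factorial x n != 0.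
Proof. by move=> xi; apply/prodf_neq0 => i _; exact: xi. Qed.

Lemma Gamma_poleN {R : realType} (x : R) (i : nat) :
  ~~ Gamma_pole x -> x + i%:R != 0.
Proof.
apply: contra => /eqP /(canRL (addrK _)); rewrite sub0r => ->.
by rewrite /Gamma_pole oppr_le0 ler0n rpredN natr_int.
Qed.

Lemma euler_GammaDn {R : realType} (x : R) (n : nat) : 0 < x ->
  euler_Gamma (x + n%:R) = rising_factorial x n * euler_Gamma x.
Proof.
move=> x0; elim: n => [|n IH].
  by rewrite addr0 /rising_factorial big_ord0 mul1r.
rewrite -natr1 addrA euler_GammaD1 ?ltr_wpDr// IH rising_factorialS.
by rewrite mulrA [in RHS]mulrAC [in RHS]mulrC mulrA.
Qed.

(** Off the poles the shift chosen in the definition of Gamma is immaterial,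
    which lets Gamma x and Gamma (x + n) be computed from the same Euler
    integral. *)
Lemma GammaE {R : realType} (x : R) (n : nat) :
  (forall i : nat, x + i%:R != 0) -> 0 < x + n%:R ->
  Gamma x = euler_Gamma (x + n%:R) / rising_factorial x n.
Proof.
move=> xi xn0; have nz k := rising_factorial_neq0 x k (fun i _ => xi i).
rewrite /Gamma; case: ifPn => [x0|].
  by rewrite euler_GammaDn// mulrAC divff// mul1r.
rewrite -leNgt => x0; rewrite -/(rising_factorial x _).
(* m is the least shift that makes x + m positive, hence m <= n. *)
set m := (Num.truncn (- x)).+1.
have xm0 : 0 < x + m%:R by rewrite -ltrBlDl sub0r truncnS_gt.
have mn : (m <= n)%N.
  rewrite /m -(ltr_nat R) (@le_lt_trans _ _ (- x))//; last by lra.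
  by rewrite truncn_le oppr_ge0.
rewrite -(subnKC mn) natrD addrA (euler_GammaDn (x + m%:R) (n - m) xm0).
rewrite rising_factorialD.
have nzm : rising_factorial (x + m%:R) (n - m) != 0.
  by apply: rising_factorial_neq0 => i _; rewrite -addrA -natrD.
by field; rewrite nz nzm.
Qed.

Lemma GammaDn {R : realType} (x : R) (n : nat) :
  (forall i : nat, x + i%:R != 0) ->
  Gamma (x + n%:R) = rising_factorial x n * Gamma x.
Proof.
move=> xi.
have xni (i : nat) : x + n%:R + i%:R != 0 by rewrite -addrA -natrD.
have [m xm] : exists m : nat, 0 < x + n%:R + m%:R.
  exists (Num.truncn (- (x + n%:R))).+1; rewrite -ltrBlDl sub0r.
  exact: truncnS_gt.
rewrite (GammaE _ m xni xm) (GammaE _ (n + m) xi) ?natrD ?addrA//.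
rewrite rising_factorialD.
have nzm : rising_factorial (x + n%:R) m != 0.
  by apply: rising_factorial_neq0 => i _.
have nz : rising_factorial x n != 0 by apply: rising_factorial_neq0 => i _.
by field; rewrite nz nzm.
Qed.

Lemma Gamma_neq0 {R : realType} (x : R) :
  (forall i : nat, x + i%:R != 0) -> Gamma x != 0.
Proof.
move=> xi; have [m xm] : exists m : nat, 0 < x + m%:R.
  exists (Num.truncn (- x)).+1; rewrite -ltrBlDl sub0r; exact: truncnS_gt.
rewrite (GammaE _ m xi xm).
apply: mulf_neq0; first by rewrite gt_eqF ?euler_Gamma_gt0.
by rewrite invr_eq0 rising_factorial_neq0.
Qed.

Lemma Gamma_nat {R : realType} (m : nat) : Gamma (m%:R + 1 : R) = m`!%:R.
Proof.
have -> : Gamma (m%:R + 1 : R) = euler_Gamma (1 + m%:R).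
  by rewrite /Gamma addrC ltr_wpDr.
rewrite euler_GammaDn// euler_Gamma1 mulr1.
elim: m => [|m IH]; first by rewrite /rising_factorial big_ord0 fact0.
by rewrite rising_factorialS IH factS mulnC natrM -natr1 [1 + _]addrC.
Qed.

(** If p is a pole then so is p + n, hence p + n <= 0 and p, ..., p + n - 1 are
    all negative. *)
Lemma rising_factorial_pole_neq0 {R : realType} (p : R) (n : nat) :
  (Gamma_pole p -> Gamma_pole (p + n%:R)) ->
  forall i, (i < n)%N -> p + i%:R != 0.
Proof.
move=> pn i lt_in; have [/pn/andP[pn0 _]|] := boolP (Gamma_pole p).
  by rewrite lt_eqF// (lt_le_trans _ pn0)// ltrD2l ltr_nat.
exact: Gamma_poleN.
Qed.

Lemma cvg_rising_factorial {R : realType} (x : R) (n : nat) :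
  rising_factorial y n @[y --> x] --> rising_factorial x n.
Proof.
elim: n => [|n IH].
  rewrite /rising_factorial big_ord0.
  by under eq_fun do rewrite big_ord0; exact: cvg_cst.
rewrite rising_factorialS; under eq_fun do rewrite rising_factorialS.
apply: cvgM => //; apply: cvgD; first exact: cvg_id.
exact: cvg_cst.
Qed.

Lemma Gamma_pole_near {R : realType} (p : R) : Gamma_pole p ->
  \forall e \near 0^', ~~ Gamma_pole (p + e).
Proof.
move=> /andP[_ pint]; near=> e; apply/negP => /andP[_ peint].
have eint : e \is a Num.int by rewrite -(addrK p e) rpredB// addrC.
have e0 : e != 0 by near: e; exact: nbhs_dnbhs_neq.
have := norm_intr_ge1 eint e0; apply/negP; rewrite -ltNge.
by near: e; exact: dnbhs0_lt.
Unshelve. all: by end_near. Qed.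

(** At a pole p the quotient is a limit along p + e with e nonzero; there
    p + e is not a pole and the quotient is the inverse of a polynomial in e
    that does not vanish at e = 0. *)
Lemma Gamma_quotE {R : realType} (p : R) (n : nat) :
  (Gamma_pole p -> Gamma_pole (p + n%:R)) ->
  Gamma_quot p (p + n%:R) = (rising_factorial p n)^-1.
Proof.
move=> pn; have nz : rising_factorial p n != 0.
  exact/rising_factorial_neq0/rising_factorial_pole_neq0.
rewrite /Gamma_quot; case: ifPn => [pole|/Gamma_poleN npole]; last first.
  have G0 : Gamma p != 0 by exact: Gamma_neq0.
  by rewrite GammaDn//; field; rewrite nz G0.
apply/cvg_lim; first exact: Rhausdorff.
apply: (@cvg_trans _ ((rising_factorial (p + e) n)^-1 @[e --> 0^'])).
  apply: near_eq_cvg; near=> e.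
  have npole i : p + e + i%:R != 0.
    by apply: Gamma_poleN; near: e; exact: Gamma_pole_near.
  have G0 : Gamma (p + e) != 0 by exact: Gamma_neq0.
  rewrite addrAC GammaDn//.
  have nze : rising_factorial (p + e) n != 0.
    by apply: rising_factorial_neq0.
  by field; rewrite nze G0.
apply: cvgV => //.
apply: cvg_within_filter.
have pe : p + e @[e --> 0] --> p.
  rewrite -[X in _ --> X](addr0 p).
  by apply: cvgD; [exact: cvg_cst|exact: cvg_id].
exact: (cvg_comp (+%R p) (fun y => rising_factorial y n) pe
  (cvg_rising_factorial p n)).
Unshelve. all: by end_near. Qed.

(** * Repeated antiderivatives of a power *)

(** The boolean b tells whether 0 belongs to the half-line, so that a hypothesis
    guarded by b is one on the behaviour at 0. *)
Definition half_line {R : realType} (b : bool) : set R :=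
  [set` Interval (BSide b 0) +oo%O].

Definition taylor_sum {R : realType} (n : nat) (c : nat -> R) (x : R) : R :=
  \sum_(j < n) c j * (x ^+ j / j`!%:R).

(** The expected general form of an n-fold antiderivative of a x^alpha; the
    coefficients c j are the integration constants. *)
Definition power_primitive {R : realType} (a alpha : R) (n : nat)
    (c : nat -> R) (x : R) : R :=
  a / rising_factorial (alpha + 1) n * x `^ (alpha + n%:R) + taylor_sum n c x.

Lemma taylor_sumS {R : realType} (n : nat) (c : nat -> R) (x : R) :
  taylor_sum n.+1 c x =
  c 0%N + \sum_(j < n) c j.+1 * (x ^+ j.+1 / j.+1`!%:R).
Proof. by rewrite /taylor_sum big_ord_recl/= fact0 divr1 mulr1. Qed.

Lemma is_derive_taylor_sum {R : realType} (n : nat) (c : nat -> R) (x : R) :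
  is_derive x 1 (taylor_sum n.+1 c) (taylor_sum n (c \o succn) x).
Proof.
have term (k : R) (j : nat) :
    is_derive x 1 (fun t => k * (t ^+ j.+1 / j.+1`!%:R))
      (k * (x ^+ j / j`!%:R)).
  have -> : (fun t : R => k * (t ^+ j.+1 / j.+1`!%:R)) =
            (k / j.+1`!%:R) \*: (id ^+ j.+1).
    by apply/funext => t /=; rewrite exprfctE /GRing.scale/= mulrCA mulrC.
  apply: is_derive_eq.
  rewrite /GRing.scale/= mulr1 factS natrM.
  have f0 : j`!%:R != 0 :> R by rewrite pnatr_eq0 -lt0n fact_gt0.
  have j0 : j.+1%:R != 0 :> R by rewrite pnatr_eq0.
  by move: j.+1%:R j0 => y y0; field; rewrite f0 y0.
have -> : taylor_sum n.+1 c = cst (c 0%N) +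
    \sum_(j < n) (fun t => c j.+1 * (t ^+ j.+1 / j.+1`!%:R)).
  by apply/funext => t; rewrite taylor_sumS [RHS]/(_ + _) fct_sumE.
rewrite -[taylor_sum _ _ _]add0r; exact: is_deriveD.
Qed.

Lemma is_derive_power_primitive {R : realType} (a alpha : R) (n : nat)
    (c : nat -> R) (x : R) : 0 < x -> alpha + 1 + n%:R != 0 ->
  is_derive x 1 (power_primitive a alpha n.+1 c)
    (power_primitive a alpha n (c \o succn) x).
Proof.
move=> x0 nz; apply: is_deriveD; last exact: is_derive_taylor_sum.
have D := is_derive1_powR (alpha + n.+1%:R) x0.
apply: (is_derive_eq (is_deriveZ (a / rising_factorial (alpha + 1) n.+1) D)).
rewrite /GRing.scale/= rising_factorialS invfM.
have -> : alpha + n.+1%:R - 1 = alpha + n%:R by rewrite -natr1 addrA addrK.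
have -> : alpha + n.+1%:R = alpha + 1 + n%:R.
  by rewrite -natr1 addrCA addrC addrAC.
by rewrite -!mulrA (mulKf nz).
Qed.

Lemma within_continuous_power_primitive {R : realType} (b : bool)
    (a alpha : R) (n : nat) (c : nat -> R) :
  (b -> 0 < alpha + n.+1%:R) ->
  {within half_line b, continuous (power_primitive a alpha n.+1 c)}.
Proof.
move=> b0; apply: within_continuousD; last first.
  apply: continuous_subspaceT => x; apply: differentiable_continuous.
  by apply/derivable1_diffP; case: (is_derive_taylor_sum n c x).
apply: within_continuousM; first by move=> t; exact: cst_continuous.
have cpos : {in `]0, +oo[, continuous (fun x : R => x `^ (alpha + n.+1%:R))}.
  move=> x; rewrite in_itv/= andbT => x0; apply: differentiable_continuous.
  by apply/derivable1_diffP; case: (is_derive1_powR (alpha + n.+1%:R) x0).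
case: b b0 => [/(_ isT) b0|_]; last first.
  rewrite continuous_open_subspace; last exact: interval_open.
  by move=> x; rewrite inE => /cpos.
apply/continuous_within_itvcyP; split => //.
by rewrite powR0 ?gt_eqF//; exact: powR_cvg0.
Qed.

Lemma antiderivative_eq {R : realType} (A : set R) (f g F G : R -> R) :
  (forall x, A x -> f x = g x) -> (forall x, A x -> F x = G x) ->
  antiderivative A f F -> antiderivative A g G.
Proof.
move=> fg FG [cF dF]; split.
  by apply: subspace_eq_continuous cF => x; rewrite inE => /FG.
move=> x Ax; rewrite -fg; last exact: interior_subset.
apply: near_eq_is_derive (dF x Ax).
by near do apply: FG.
Unshelve. all: by end_near. Qed.

(** The difference of the two antiderivatives is constant on every segment of
    the half-line by the mean value theorem; a segment starting at 0 is
    covered because only continuity is needed at its endpoints. *)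
Lemma antiderivative_unique {R : realType} (b : bool) (f F G : R -> R) :
  antiderivative (half_line b) f F -> antiderivative (half_line b) f G ->
  exists C, forall x, half_line b x -> F x = C + G x.
Proof.
move=> [cF dF] [cG dG].
have flat x y : half_line b x -> x <= y ->
    F x - G x = F y - G y.
  move=> bx xy.
  have sub : `[x, y]%classic `<=` half_line b.
    move: bx; rewrite /half_line/= => bx t /=; rewrite !in_itv/= andbT in bx *.
    move=> /andP[xt _]; case: b bx {cF dF cG dG} => /= bx.
      rewrite andbT; exact: le_trans bx xt.
    rewrite andbT; exact: lt_le_trans bx xt.
  have [||t _ /eqP] := @MVT_segment R (F - G) (fun=> 0) x y xy.
  - move=> t txy; rewrite -(subrr (f t)).
    have t0 : (half_line b)° t.
      rewrite /half_line interior_itv_bndy/= in_itv/= andbT.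
      move: txy bx; rewrite in_itv/= => /andP[xt _].
      rewrite /half_line/= in_itv/= andbT; case: b {cF dF cG dG sub} => /= bx.
        exact: le_lt_trans bx xt.
      exact: lt_trans bx xt.
    by apply: is_deriveB; [exact: dF|exact: dG].
  - by apply: continuous_subspaceW sub _; exact: within_continuousB.
  - by rewrite mul0r subr_eq0 => /eqP/esym.
have b1 : half_line b (1 : R).
  rewrite /half_line/= in_itv/= andbT; case: b {cF dF cG dG flat} => /=.
    exact: ler01.
  exact: ltr01.
exists (F 1 - G 1) => x bx; apply/eqP; rewrite -subr_eq; apply/eqP.
by have [x1|/ltW x1] := leP x 1; [exact: flat|apply/esym; exact: flat].
Qed.

(** At each integration the old constants move up by one place and the new
    constant becomes the coefficient of index 0. *)
Lemma indefinite_integralsE {R : realType} (b : bool) (a alpha : R) (n : nat) :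
  (b -> - 1 < alpha) -> (forall i, (i < n)%N -> alpha + 1 + i%:R != 0) ->
  indefinite_integrals (half_line b) n (fun x => a * x `^ alpha) =
  [set F : R -> R | exists c, forall x, half_line b x ->
     F x = power_primitive a alpha n c x].
Proof.
move=> b1; elim: n => [|n IH] nz.
  have E c x : power_primitive a alpha 0 c x = a * x `^ alpha.
    rewrite /power_primitive /rising_factorial /taylor_sum !big_ord0.
    by rewrite divr1 !addr0.
  apply/seteqP; split=> F /=; first by move=> FE; exists (fun=> 0) => x /FE ->.
  by move=> [c FE] x /FE ->.
have prim c : antiderivative (half_line b)
    (power_primitive a alpha n (c \o succn)) (power_primitive a alpha n.+1 c).
  split.
    apply: within_continuous_power_primitive => /b1.
    by rewrite -natr1; have := ler0n R n; lra.
  move=> x; rewrite /half_line interior_itv_bndy/= in_itv/= andbT => x0.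
  by apply: is_derive_power_primitive => //; exact: nz.
rewrite /= IH => [|i lt_in]; last by rewrite nz// ltnW.
apply/seteqP; split=> F /=.
  move=> [G [c GE] FG].
  have FP : antiderivative (half_line b) (power_primitive a alpha n c) F.
    exact: antiderivative_eq FG.
  have [C FC] := antiderivative_unique _ _ _ _ FP
    (prim (fun j => if j is i.+1 then c i else 0)).
  exists (fun j => if j is i.+1 then c i else C) => x /FC ->.
  by rewrite /power_primitive !taylor_sumS add0r addrCA.
move=> [c FE]; exists (power_primitive a alpha n (c \o succn)).
  by exists (c \o succn).
by apply: antiderivative_eq (prim c) => // x /FE.
Qed.

(** * Derivatives of negative integer order *)

Lemma entire_part_opp_nat (n : nat) : entire_part (- n%:R) = - n%:Z.
Proof.
rewrite /entire_part oppr_ge0; case: n => [|n].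
  by rewrite lexx oppr0 floor0.
by rewrite lern0/= -[n.+1%:R]/(n.+1%:Z%:~R) -rmorphN/= intrKceil.
Qed.

(** The index j of the sum stands for k = -(j+1), so that k - s = n-1-j: the
    powers occur in decreasing order and the sum has to be reversed.  The
    coefficient of x^i / i! is then the constant of index k = i - n. *)
Lemma monomial_derivE {R : realType} (n : nat) (a alpha : R) (c : int -> R)
    (x : R) : deriv_defined (- n%:R) alpha -> 0 <= x ->
  monomial_deriv (- n%:R) a alpha c x =
  power_primitive a alpha n (fun i => c (i%:Z - n%:Z)) x.
Proof.
move=> [_ pole] x0; rewrite /monomial_deriv /power_primitive.
rewrite rmorphN/= ratr_nat opprK addrAC in pole *.
rewrite Gamma_quotE//; congr (_ + _).
rewrite entire_part_opp_nat abszN absz_nat /taylor_sum.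
rewrite (reindex_inj rev_ord_inj)/=; apply: eq_bigr => j _.
have -> : - (n - j.+1).+1%:Z = j%:Z - n%:Z by have := ltn_ord j; lia.
rewrite intrB opprK subrK -/(j%:R : R); congr (_ * _).
rewrite subrK -[j%:~R]/(j%:R) Gamma_nat.
by rewrite powR_mulrn.
Qed.

Lemma derivativesE {R : realType} (b : bool) (n : nat) (a alpha : R) :
  deriv_defined (- n%:R) alpha ->
  derivatives (half_line b) (- n%:R) a alpha =
  [set F : R -> R | exists c, forall x, half_line b x ->
     F x = power_primitive a alpha n c x].
Proof.
move=> def; have ge0 (x : R) : half_line b x -> 0 <= x.
  by rewrite /half_line/= in_itv/= andbT; case: b => // /ltW.
apply/seteqP; split=> F /= [c FE].
  exists (fun i => c (i%:Z - n%:Z)) => x bx.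
  by rewrite FE// monomial_derivE// ge0.
exists (fun k => c (absz (k + n%:Z))) => x bx.
rewrite FE// monomial_derivE ?ge0// /power_primitive /taylor_sum.
by congr (_ + _); apply: eq_bigr => i _; rewrite subrK.
Qed.

Theorem theorem4p5 (R : realType) (n : nat) (a alpha : R)
    (halpha : deriv_defined (- n%:R) alpha) :
  derivatives `]0, +oo[ (- n%:R) a alpha =
    indefinite_integrals `]0, +oo[ n (fun x => a * x `^ alpha) /\
  (- 1 < alpha ->
   derivatives `[0, +oo[ (- n%:R) a alpha =
     indefinite_integrals `[0, +oo[ n (fun x => a * x `^ alpha)).
Proof.
have nz i : (i < n)%N -> alpha + 1 + i%:R != 0.
  case: halpha => _; rewrite rmorphN/= ratr_nat opprK addrAC => pole.
  exact: rising_factorial_pole_neq0.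
split=> [|alpha1].
- rewrite -[`]0, +oo[%classic]/(half_line false).
  by rewrite derivativesE// indefinite_integralsE.
- rewrite -[`[0, +oo[%classic]/(half_line true).
  by rewrite derivativesE// indefinite_integralsE.
Qed.
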